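(* Let $\mathcal{X}_1,\ldots,\mathcal{X}_d$ be Polish spaces. Let $\mathbb{S}$ be a collection of subsets of $[d]$, and suppose that $J \subseteq [d]$ is such that $J \subseteq S$ for every $S \in \mathbb{S}$. Let $P_{\mathbb{S}} = (P_S : S \in \mathbb{S}) \in \mathcal{P}_{\mathbb{S}}$ and suppose further that there exists a distribution $P^J$ on $\mathcal{X}_J$ such that $P_S^J = P^J$ for all $S \in \mathbb{S}$. Then \[ R(P_{\mathbb{S}}) \leq \int_{\mathcal{X}_J} R(P_{\mathbb{S}|x_J}) \, dP^J(x_J). \] Moreover, in the discrete case where $\mathcal{X}_j = [m_j]$ for some $m_1,\ldots,m_d \in \mathbb{N} \cup \{\infty\}$, this inequality is in fact an equality.
   Context: Let $d \in \mathbb{N}$, $[m] := \{1,\ldots,m\}$ for $m\in\mathbb{N}$, $[\infty] := \mathbb{N}$ (with discrete topology), $\mathcal{X}_S := \prod_{j \in S}\mathcal{X}_j$ with the product topology (a one-point space if $S=\emptyset$), $\mathcal{X} := \mathcal{X}_{[d]}$, $x_S := (x_j : j \in S)$, $J^c := [d] \setminus J$. $\mathcal{P}_{\mathbb{S}}$ is the set of sequences $(P_S : S \in \mathbb{S})$ with $P_S$ a Borel probability distribution on $\mathcal{X}_S$. For $T \subseteq S$, $P_S^T$ denotes the marginal of $P_S$ on $\mathcal{X}_T$. Disintegration: for $S \in \mathbb{S}$, $(P_{S|x_J} : x_J \in \mathcal{X}_J)$ is a family of probability measures on $\mathcal{X}_{S \cap J^c}$ such that $x_J \mapsto P_{S|x_J}(B)$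 is measurable for every measurable $B \subseteq \mathcal{X}_{S \cap J^c}$, and $\int_A P_{S|x_J}(B)\, dP_S^J(x_J) = P_S(A \times B)$ for all measurable $A \subseteq \mathcal{X}_J$, $B \subseteq \mathcal{X}_{S\cap J^c}$ (such a family exists because the spaces are Polish). Write $P_{\mathbb{S}|x_J} := (P_{S|x_J} : S \in \mathbb{S})$, a sequence of distributions corresponding to the collection $\mathbb{S}^{-J} := \{S \cap J^c : S \in \mathbb{S}\}$ of subsets of $J^c$. Incompatibility index: let $\mathcal{G}_S$ be the set of bounded upper semi-continuous functions $\mathcal{X}_S \to [-1,\infty)$ and $\mathcal{G}_{\mathbb{S}}^+ := \{ f_{\mathbb{S}} = (f_S : S \in \mathbb{S}) \in \prod_{S \in \mathbb{S}} \mathcal{G}_S : \inf_{x \in \mathcal{X}} \sum_{S \in \mathbb{S}} f_S(x_S) \geq 0 \}$. Then $R(P_{\mathbb{S}}) := \sup_{f_{\mathbb{S}} \in \mathcal{G}_{\mathbb{S}}^+} \bigl\{-\frac{1}{|\mathbb{S}|}\sum_{S \in \mathbb{S}} \int_{\mathcal{X}_S} f_S \, dP_S\bigr\}$. The quantity $R(P_{\mathbb{S}|x_J})$ is defined in the same way with $\mathbb{S}$ replaced by $\mathbb{S}^{-J}$ and $\mathcal{X}$ replaced by $\mathcal{X}_{J^c}$. *)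

(* Defs.v *)
From HB Require Import structures.
From mathcomp Require Import all_boot all_order all_algebra.
From mathcomp Require Import all_classical all_reals all_analysis.
From mathcomp Require Import measurable_realfun.

Set Implicit Arguments.
Unset Strict Implicit.
Unset Printing Implicit Defensive.

Import Order.TTheory GRing.Theory Num.Theory.
Import numFieldNormedType.Exports.

Local Open Scope classical_set_scope.
Local Open Scope ring_scope.

Definition polish (R : realType) (T : topologicalType) : Prop :=
  (exists2 D : set T, countable D & dense D) /\
  exists dist : T -> T -> R,
    [/\ (forall x y, dist x y = 0 <-> x = y),
        (forall x y, dist x y = dist y x),
        (forall x y z, dist x z <= dist x y + dist y z),
        (forall (x : T) (A : set T), nbhs x A <->
           exists2 e : R, 0 < e & [set y | dist x y < e] `<=` A) &
        (forall u : nat -> T,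
           (forall e : R, 0 < e -> exists N : nat, forall m n : nat,
              (N <= m)%N -> (N <= n)%N -> dist (u m) (u n) < e) ->
           exists l : T, u @ \oo --> l)].

Notation borel T := (g_sigma_algebraType (@open T)).

Section products.
Context {I : finType} (X : I -> ptopologicalType).

Definition prodS (S : {set I}) : Type :=
  prod_topology (fun j : {j : I | j \in S} => X (val j)).

HB.instance Definition _ (S : {set I}) := Topological.on (prodS S).
HB.instance Definition _ (S : {set I}) := isPointed.Build (prodS S)
  (fun j : {j : I | j \in S} => (point : X (val j))).

Definition restr (S T : {set I}) (TS : T \subset S) (x : prodS S) : prodS T :=
  fun j => x (exist _ (val j) (fintype.subsetP TS _ (valP j))).

Lemma restr_continuous (S T : {set I}) (TS : T \subset S) :
  continuous (restr TS).
Proof.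
move=> x; apply/cvg_sup => j.
apply: (@continuous_comp_initial _ (prodS S) _ _ (restr TS)).
exact: (@proj_continuous {j : I | j \in S} (fun j => X (val j))
  (exist _ (val j) (fintype.subsetP TS _ (valP j)))).
Qed.

Lemma restr_measurable (S T : {set I}) (TS : T \subset S) :
  measurable_fun [set: borel (prodS S)]
    (restr TS : borel (prodS S) -> borel (prodS T)).
Proof.
apply: (@measurability _ _ (borel (prodS S)) (borel (prodS T)) setT
  (restr TS) (@open (prodS T))) => // _ [B oB <-].
rewrite setTI; apply: sub_sigma_algebra.
by move/continuousP: (restr_continuous (TS := TS)); exact.
Qed.

Definition restr_mfun (S T : {set I}) (TS : T \subset S) :
    {mfun borel (prodS S) >-> borel (prodS T)} :=
  HB.pack (restr TS) (isMeasurableFun.Build _ _ (borel (prodS S))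
    (borel (prodS T)) (restr TS) (restr_measurable TS)).

Context {R : realType}.

Definition marginal (S T : {set I}) (TS : T \subset S)
    (P : probability (borel (prodS S)) R) : probability (borel (prodS T)) R :=
  distribution P (restr_mfun TS).

Definition disintegration (J S : {set I}) (JS : J \subset S)
    (P : probability (borel (prodS S)) R)
    (Q : prodS J -> probability (borel (prodS (S :&: ~: J))) R) : Prop :=
  (forall B : set (borel (prodS (S :&: ~: J))), measurable B ->
     measurable_fun [set: borel (prodS J)] (fun xJ => Q xJ B : \bar R)) /\
  (forall (A : set (borel (prodS J))) (B : set (borel (prodS (S :&: ~: J)))),
     measurable A -> measurable B ->
     (\int[marginal JS P]_(xJ in A) Q xJ B =
      P (restr JS @^-1` A `&` restr (finset.subsetIl S (~: J)) @^-1` B))%E).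

Definition usc_bounded (T : topologicalType) : set (T -> R) :=
  [set f : T -> R | [/\ (forall x, - 1 <= f x),
                        bounded_fun (f : T -> R^o) &
                        lower_semicontinuous (fun x => (- f x)%:E)]].

(* The index of a sequence of distributions is taken for a finite family of
   subsets of U rather than a set of subsets. A collection SS is the family of
   its own members; {S :&: ~: J | S in SS} is the family S |-> S :&: ~: J
   indexed by SS, which is injective when J is contained in every S in SS, so
   that both indices are normalised by #|SS|. *)
Section incompatibility_index.
Context (U : {set I}) (K : finType) (s : K -> {set I}).
Context (sU : forall k, s k \subset U).

Definition Gplus : set (forall k, prodS (s k) -> R) :=
  [set f | (forall k, f k \in @usc_bounded (prodS (s k))) /\
     (0 <= ereal_inf
             (range (fun x : prodS U => (\sum_k f k (restr (sU k) x))%:E)))%E].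

Definition incompat (P : forall k, probability (borel (prodS (s k))) R) :
    \bar R :=
  ereal_sup
    [set (- ((#|K|%:R^-1)%:E * \sum_k \int[P k]_x (f k x)%:E))%E
    | f in Gplus].

End incompatibility_index.

End products.

(* None stands for m = infinity. *)
Definition initial_segment (m : option nat) : set nat :=
  [set k | (0 < k)%N /\ if m is Some n then (k <= n)%N else True].

(* T is [m] with the discrete topology, up to relabelling of its points. *)
Definition discrete_segment (T : topologicalType) (m : option nat) : Prop :=
  (forall A : set T, open A) /\
  exists f : T -> nat, set_bij [set: T] (initial_segment m) f.

(* Main.v *)
Require Import Defs.
From HB Require Import structures.
From mathcomp Require Import all_boot all_order all_algebra.
From mathcomp Require Import all_classical all_reals all_analysis.
From mathcomp Require Import measurable_realfun.

Set Implicit Arguments.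
Unset Strict Implicit.
Unset Printing Implicit Defensive.

Import Order.TTheory GRing.Theory Num.Theory.
Import numFieldNormedType.Exports.

Local Open Scope classical_set_scope.
Local Open Scope ring_scope.

(** Fix a value x of the coordinates in J. If a family f is admissible for the
collection (each f_S bounded, upper semi-continuous and at least -1, with a
nonnegative sum), then the family of its slices y |-> f_S (x, y) is admissible
for the collection of the sets S minus J. By disintegration, the value of f at
P is the integral over P^J of the values of its slices at Q(x)
(payoff_disintegration), and each of these is at most R(Q(x)). Taking the
supremum over f gives the inequality (incompat_le).

The disintegration is only given on rectangles A x B. It extends to integrals
of bounded Borel functions (integral_disintegration) because rectangles form a
pi-system generating the Borel sigma-algebra of X_S. This is where second
countability enters: in a finite product of second countable spaces every open
set is a countable union of open boxes, so that the Borel sigma-algebra is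
generated by the coordinates (borel_prodS_cylinders). For the same reason the
map (x, y) |-> z joining two blocks of coordinates is measurable for the
product of the Borel sigma-algebras.

The function x |-> R(Q(x)) is a supremum of an uncountable family, so its
integral is only known to be a lower integral, the supremum of the integrals
of the simple functions below it. Both inequalities rest on the monotonicity
of this lower integral (le_lower_integral).

In the discrete case every set is open in X_J and in X_S, so all functions on
these spaces are continuous and measurable. One can therefore choose for each
x an admissible family that is e-optimal for R(Q(x)) and paste these families
into a single one over the collection of the sets S. The pasted functions may
fail to be bounded in x, so they are first truncated from above at the number
of sets in the collection. Truncation can only increase the value, and it
preserves nonnegativity of the sum since the other terms are at least -1
(sum_min_card_ge0). The value of the pasted family is then at least the
integral of R(Q(x)) minus e (incompat_ge). *)

(** * Integrals *)

(** The integral of a nonnegative function, measurable or not, is the supremum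
of the integrals of the simple functions below it, and this supremum is
monotone in the function. *)
Lemma le_lower_integral {d} {T : measurableType d} {R : realType}
  (mu : {measure set T -> \bar R}) (g F : T -> \bar R) :
  (forall x, 0 <= F x)%E -> (forall x, g x <= F x)%E ->
  (\int[mu]_x g x <= \int[mu]_x F x)%E.
Proof.
move=> F0 gF; rewrite integralE.
apply: (@le_trans _ _ (\int[mu]_x g^\+ x)%E).
  by rewrite -[leRHS]sube0 leeB// integral_ge0.
rewrite !ge0_integralTE//; apply: le_ereal_sup => _ [h /= hg <-].
exists h => // x; apply: le_trans (hg x) _.
by rewrite funeposE ge_max F0 gF.
Qed.

Lemma probability_bounded_integrable {d} {T : measurableType d} {R : realType}
  (mu : probability T R) (f : T -> R) :
  measurable_fun setT f -> (exists M, forall z, `|f z| <= M) ->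
  mu.-integrable setT (EFin \o f).
Proof.
move=> mf [M fM]; apply: measurable_bounded_integrable => //.
  by rewrite (@le_lt_trans _ _ 1%E) ?ltry// probability_le1.
exists M; split; rewrite ?num_real// => r Mr x _.
exact: le_trans (fM x) (ltW Mr).
Qed.

Lemma probability_integral_cst {d} {T : measurableType d} {R : realType}
  (mu : probability T R) (c : R) : (\int[mu]_x c%:E = c%:E)%E.
Proof.
rewrite integral_cst// -[RHS]mule1; congr (_ * _)%E.
exact: probability_setT.
Qed.

(** * Borel sets of a finite product of second countable spaces *)

(** The balls of radius 1/(k+1) centred at a point of a countable dense set
form a base: a ball of radius e around x contains the ball of radius
1/(k+1) < e/2 around any point of the dense set at distance less than 1/(k+1)
from x. *)
Lemma polish_second_countable (R : realType) (T : ptopologicalType) :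
  polish R T -> @second_countable T.
Proof.
move=> [[D /countable_injP[f finj] denseD] [dist [dist0 distC distD nbhsE _]]].
have dxx x : dist x x = 0 by apply/dist0.
have ball_opn x (e : R) : open [set y | dist x y < e].
  rewrite openE => y /= xy; apply/nbhsE; exists (e - dist x y).
    by rewrite subr_gt0.
  move=> z /=; rewrite ltrBrDl; exact: le_lt_trans.
(* The points of D are numbered by the injection f. *)
pose center n := xget (point : T) [set x | D x /\ f x = n].
pose ball (n : nat * nat) := [set y | dist (center n.1) y < n.2.+1%:R^-1].
exists (range ball).
  exact: sub_countable (card_image_le _ _) (countableP _).
split=> [_ [n _ <-]|x O /nbhsE[e e0 eO]]; first exact: ball_opn.
have e20 : 0 < e / 2 by rewrite divr_gt0.
have /= [k _ kP] := near_infty_natSinv_lt (PosNum e20).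
have {}kP := kP k (leqnn k).
have k0 : 0 < k.+1%:R^-1 :> R by rewrite invr_gt0.
have [y [xy Dy]] : [set y | dist x y < k.+1%:R^-1] `&` D !=set0.
  by apply: denseD => //; exists x; rewrite /= dxx.
have cy : center (f y) = y.
  apply: xget_unique => // z [Dz fzy].
  by apply: finj; rewrite ?inE.
exists (ball (f y, k)).
  by split; [exists (f y, k)|rewrite /ball/= cy distC].
move=> z; rewrite /ball/= cy => yz; apply: eO => /=.
apply: le_lt_trans (distD _ y _) _.
by rewrite (splitr e) ltrD// (lt_trans _ kP).
Qed.

Lemma second_countable_enum (T : topologicalType) : @second_countable T ->
  exists e : nat -> set T, (forall n, open (e n)) /\
    forall x O, nbhs x O -> exists n, e n x /\ e n `<=` O.
Proof.
move=> [B /countable_injP[f finj] [Bopen Bbase]].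
(* The default value setT keeps all members of the sequence open. *)
exists (fun n => xget setT [set A | B A /\ f A = n]); split => [n|x O xO].
  by case: xgetP => [A -> [BA _]|_]; [exact: Bopen|exact: openT].
have [A [BA Ax] AO] := Bbase x O xO; exists (f A).
rewrite (_ : xget _ _ = A)//; apply: xget_unique => // C [BC fCA].
by apply: finj; rewrite ?inE.
Qed.

Section coordinate_cylinders.
Context {I : finType} (X : I -> ptopologicalType).

Definition coordinate_cylinders {S : {set I}} : set (set (prodS X S)) :=
  [set A | exists (j : {j | j \in S}) (O : set (X (val j))),
     open O /\ A = (fun x : prodS X S => x j) @^-1` O].

(** The open boxes whose sides belong to countable bases are countably many,
and an open set is the union of those it contains. *)
Lemma open_coordinate_cylinders (S : {set I}) (U : set (prodS X S)) :
  (forall j, @second_countable (X j)) ->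
  open U -> <<s coordinate_cylinders >> U.
Proof.
move=> base oU.
pose e j := sval (cid (second_countable_enum (base j))).
have eP j := svalP (cid (second_countable_enum (base j))).
pose N := {ffun {j | j \in S} -> nat}.
pose box (n : N) : set (prodS X S) :=
  \bigcap_j ((fun x : prodS X S => x j) @^-1` e (val j) (n j)).
have -> : U = \bigcup_(n : N) (if asbool (box n `<=` U) then box n else set0).
  rewrite eqEsubset; split => [x Ux|x [n _]]; last first.
    by case: asboolP => [boxU /boxU|_ []].
  (* The boxes around x generate a filter, which converges to x because each of
     its coordinates does; hence one of them is contained in U. *)
  pose F : set_system (prodS X S) := filter_from [set n | box n x] box.
  have /choice[n0 n0P] (j : {j | j \in S}) : exists n, e (val j) n (x j).
    by have [n []] := (eP (val j)).2 (x j) setT filterT; exists n.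
  have FF : Filter F.
    apply: filter_from_filter.
      by exists [ffun j => n0 j] => j _ /=; rewrite ffunE; exact: n0P.
    move=> m n mx nx.
    have /choice[k kP] (j : {j | j \in S}) : exists k, e (val j) k (x j) /\
        e (val j) k `<=` e (val j) (m j) `&` e (val j) (n j).
      apply: (eP (val j)).2; apply: filterI; apply: open_nbhs_nbhs; split.
      - exact: (eP (val j)).1.
      - exact: mx.
      - exact: (eP (val j)).1.
      - exact: nx.
    exists [ffun j => k j] => [j _|y yk]/=.
      by rewrite ffunE; case: (kP j).
    by split => j _; have := yk j Logic.I; rewrite /= ffunE => /(kP j).2 [].
  have : F --> x.
    apply/cvg_sup => j A [B [ [V oV VB] Bx BA]].
    have [n [nx nO]] : exists n, e (val j) n (x j) /\ e (val j) n `<=` V.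
      apply: (eP (val j)).2; apply: open_nbhs_nbhs; split => //.
      by move: Bx; rewrite -VB.
    (* Only the side in the direction j has to be small. *)
    exists [ffun i => if i == j then n else n0 i].
      by move=> i _ /=; rewrite ffunE; case: eqP => [->|_] //; exact: n0P.
    move=> y yn; apply: BA; rewrite -VB; apply: nO.
    by have := yn j Logic.I; rewrite /= ffunE eqxx.
  move=> /(_ U) []; first exact: open_nbhs_nbhs.
  by move=> n nx nU; exists n => //; case: asboolP.
apply: (@countable_bigcupT_measurable _
  (g_sigma_algebraType (@coordinate_cylinders S))).
  exact: countableP.
move=> n; case: asboolP => // _.
apply: (@fin_bigcap_measurable _
  (g_sigma_algebraType (@coordinate_cylinders S))) => //.
move=> j _; apply: sub_sigma_algebra; exists j, (e (val j) (n j)); split => //.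
exact: (eP (val j)).1.
Qed.

Lemma measurable_coordinate (S : {set I}) (j : {j | j \in S})
    (A : set (X (val j))) : open A ->
  measurable ((fun x : prodS X S => x j) @^-1` A : set (borel (prodS X S))).
Proof.
move=> oA; apply: sub_sigma_algebra.
apply: (@open_comp (prodS X S) (X (val j))) => // x _.
exact: (@proj_continuous {j : I | j \in S} (fun j => X (val j)) j).
Qed.

Lemma borel_prodS_cylinders (S : {set I}) :
  (forall j, @second_countable (X j)) ->
  @measurable _ (borel (prodS X S)) = <<s coordinate_cylinders >>.
Proof.
move=> base; rewrite eqEsubset; split => A; apply: smallest_sub.
- exact: smallest_sigma_algebra.
- by move=> B; exact: open_coordinate_cylinders.
- exact: sigma_algebra_measurable.
- by move=> _ [j [B [oB ->]]]; exact: measurable_coordinate.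
Qed.

End coordinate_cylinders.

(** * Joining two blocks of coordinates *)

Section joining.
Context {I : finType} (X : I -> ptopologicalType).

Lemma restrE (S T : {set I}) (TS : T \subset S) (z : prodS X S)
  (j : {j | j \in S}) (jT : val j \in T) :
  restr TS z (exist _ (val j) jT) = z j.
Proof.
case: j jT => j jS /= jT; rewrite /restr.
by congr (z (exist _ _ _)); exact: bool_irrelevance.
Qed.

Lemma restr_restr (U S T : {set I}) (TS : T \subset S) (SU : S \subset U)
  (TU : T \subset U) (z : prodS X U) : restr TS (restr SU z) = restr TU z.
Proof.
apply: functional_extensionality_dep => -[j jT]; rewrite /restr /=.
by congr (z (exist _ _ _)); exact: bool_irrelevance.
Qed.

Section joinS.
Context (J W S : {set I}) (cov : S \subset J :|: W).

Lemma joinS_mem j : j \in S -> j \notin J -> j \in W.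
Proof. by move=> /(fintype.subsetP cov); rewrite inE => /orP[->|]. Qed.

(** The second block is only required to contain the coordinates of S missing
from J, so that the same map joins J with a set S minus J inside S and with
the complement of J inside the full product; restr_joinS compares the two. *)
Definition joinS (x : prodS X J) (y : prodS X W) : prodS X S := fun j =>
  match pselect (val j \in J) with
  | left jJ => x (exist _ (val j) jJ)
  | right jJ => y (exist _ (val j) (joinS_mem (valP j) (introN idP jJ)))
  end.

Lemma joinSJ x y (j : {j | j \in S}) (jJ : val j \in J) :
  joinS x y j = x (exist _ (val j) jJ).
Proof.
rewrite /joinS; case: pselect => [h|//].
by congr (x (exist _ _ _)); exact: bool_irrelevance.
Qed.

Lemma joinSW x y (j : {j | j \in S}) (jJ : val j \notin J) (jW : val j \in W) :
  joinS x y j = y (exist _ (val j) jW).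
Proof.
rewrite /joinS; case: pselect => [h|h]; first by rewrite h in jJ.
by congr (y (exist _ _ _)); exact: bool_irrelevance.
Qed.

Lemma joinS_continuous x : continuous (joinS x).
Proof.
move=> y; apply/cvg_sup => j.
apply: (@continuous_comp_initial _ (prodS X W) _ _ (joinS x)).
have [jJ|jJ] := boolP (val j \in J).
  rewrite (_ : _ \o _ = fun=> x (exist _ (val j) jJ)); last first.
    by apply/funext => z /=; rewrite /proj/= (joinSJ _ _ jJ).
  exact: cst_continuous.
have jW := joinS_mem (valP j) jJ.
rewrite (_ : _ \o _ = fun z : prodS X W => z (exist _ (val j) jW)).
  exact: (@proj_continuous {j : I | j \in W} (fun j => X (val j))
    (exist _ (val j) jW)).
by apply/funext => z /=; rewrite /proj/= (joinSW _ _ jJ jW).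
Qed.

(** Joint continuity would only give measurability for the Borel sets of the
product space. For the product of the Borel sigma-algebras it is enough to
look at the preimage of a coordinate cylinder, which is a cylinder in one of
the two blocks. *)
Lemma joinS_measurable :
  (forall j, @second_countable (X j)) ->
  measurable_fun [set: borel (prodS X J) * borel (prodS X W)]
    (fun p => joinS p.1 p.2 : borel (prodS X S)).
Proof.
move=> base.
apply: (@measurability _ _ _ (borel (prodS X S)) _ _ _
  (borel_prodS_cylinders S base)).
move=> _ [_ [j [A [oA ->]]] <-]; rewrite setTI.
have [jJ|jJ] := boolP (val j \in J).
  rewrite [X in measurable X](_ : _ =
    fst @^-1` ((fun x : prodS X J => x (exist _ (val j) jJ)) @^-1` A)).
    rewrite -[X in measurable X]setTI.
    apply: measurable_fst => //.
    exact: (measurable_coordinate (j := exist _ (val j) jJ)).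
  by apply/seteqP; split => p /=; rewrite (joinSJ _ _ jJ).
have jW := joinS_mem (valP j) jJ.
rewrite [X in measurable X](_ : _ =
  snd @^-1` ((fun x : prodS X W => x (exist _ (val j) jW)) @^-1` A)).
  rewrite -[X in measurable X]setTI.
  apply: measurable_snd => //.
  exact: (measurable_coordinate (j := exist _ (val j) jW)).
by apply/seteqP; split => p /=; rewrite (joinSW _ _ jJ jW).
Qed.

End joinS.

Lemma restr_joinSJ (J W S : {set I}) (cov : S \subset J :|: W)
  (JS : J \subset S) (x : prodS X J) (y : prodS X W) :
  restr JS (joinS cov x y) = x.
Proof.
apply: functional_extensionality_dep => -[j jS]; rewrite /restr.
rewrite (@joinSJ _ _ _ _ _ _ (exist _ j _) jS) /=.
by congr (x (exist _ _ _)); exact: bool_irrelevance.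
Qed.

Lemma restr_joinSW (J W S : {set I}) (cov : S \subset J :|: W)
  (WS : W \subset S) (x : prodS X J) (y : prodS X W) : W \subset ~: J ->
  restr WS (joinS cov x y) = y.
Proof.
move=> WJ; apply: functional_extensionality_dep => -[j jS]; rewrite /restr.
have jJ : j \notin J by have := fintype.subsetP WJ _ jS; rewrite inE.
rewrite (@joinSW _ _ _ _ _ _ (exist _ j _) jJ jS) /=.
by congr (y (exist _ _ _)); exact: bool_irrelevance.
Qed.

Lemma restr_joinS (J W S W' S' : {set I}) (cov : S \subset J :|: W)
  (cov' : S' \subset J :|: W') (SS : S' \subset S) (WW : W' \subset W)
  (x : prodS X J) (y : prodS X W) :
  restr SS (joinS cov x y) = joinS cov' x (restr WW y).
Proof.
apply: functional_extensionality_dep => -[j jS]; rewrite {1}/restr.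
have [jJ|jJ] := boolP (j \in J); first rewrite
    (@joinSJ _ _ _ _ _ _ (exist _ j jS) jJ).
  by rewrite (@joinSJ _ _ _ _ _ _ (exist _ j _) jJ).
have jW' := joinS_mem cov' jS jJ.
have jW := fintype.subsetP WW _ jW'.
rewrite (@joinSW _ _ _ _ _ _ (exist _ j jS) jJ jW').
rewrite (@joinSW _ _ _ _ _ _ (exist _ j _) jJ jW) /=.
by rewrite /restr; congr (y (exist _ _ _)); exact: bool_irrelevance.
Qed.

End joining.

(** * Disintegration of integrals *)

Lemma subset_setU_setIC {I : finType} (J S : {set I}) :
  S \subset J :|: (S :&: ~: J).
Proof.
by apply/fintype.subsetP => j jS; rewrite !inE jS orbN.
Qed.

Section disintegration_integral.
Context {I : finType} (X : I -> ptopologicalType) {R : realType}.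
Hypothesis base : forall j, @second_countable (X j).
Context (J S : {set I}) (JS : J \subset S).
Notation W := (S :&: ~: J).
Context (P : probability (borel (prodS X S)) R).
Context (Q : prodS X J -> probability (borel (prodS X W)) R).
Hypothesis disQ : disintegration JS P Q.

Notation cov := (subset_setU_setIC J S).

Lemma joinS_section_measurable (x : prodS X J) :
  measurable_fun [set: borel (prodS X W)]
    (joinS cov x : borel (prodS X W) -> borel (prodS X S)).
Proof.
have gm := joinS_measurable cov base.
exact: (measurableT_comp gm (pair1_measurable (x : borel (prodS X J)))).
Qed.

Definition joinS_mfun (x : prodS X J) :
    {mfun borel (prodS X W) >-> borel (prodS X S)} :=
  HB.pack (joinS cov x) (isMeasurableFun.Build _ _ (borel (prodS X W))
    (borel (prodS X S)) (joinS cov x) (joinS_section_measurable x)).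

(** An alias of Q, to which the structure of a probability kernel is
attached. *)
Definition cond_kernel :
    borel (prodS X J) -> {measure set (borel (prodS X W)) -> \bar R} :=
  fun x => Q x.

HB.instance Definition _ := isKernel.Build _ _ (borel (prodS X J))
  (borel (prodS X W)) R cond_kernel disQ.1.

Let cond_kernel1 x : cond_kernel x setT = 1%E.
Proof. exact: probability_setT. Qed.

HB.instance Definition _ := Kernel_isProbability.Build _ _ (borel (prodS X J))
  (borel (prodS X W)) R cond_kernel cond_kernel1.

(** The law on X_S of (x, y) for a fixed x and y distributed as Q(x). The
factor unit is the parameter space on which composition of kernels
depends. *)
Definition joined_kernel :
    unit * borel (prodS X J) -> {measure set (borel (prodS X S)) -> \bar R} :=
  fun p => distribution (Q p.2) (joinS_mfun p.2).

Let joined_kernel_measurable (A : set (borel (prodS X S))) : measurable A ->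
  measurable_fun [set: unit * borel (prodS X J)] (joined_kernel ^~ A).
Proof.
move=> mA.
have gm := joinS_measurable cov base.
have mgA := gm measurableT _ mA; rewrite setTI in mgA.
have := @measurable_fun_xsection_finite_kernel _ _ _ _ _ cond_kernel _
  (mem_set mgA).
move=> /measurableT_comp/(_ measurable_snd) h.
apply: eq_measurable_fun (h _ _) => -[u x] _ /=.
by rewrite /cond_kernel xsectionE.
Qed.

HB.instance Definition _ := isKernel.Build _ _ (unit * borel (prodS X J))%type
  (borel (prodS X S)) R joined_kernel joined_kernel_measurable.

Let joined_kernel1 p : joined_kernel p setT = 1%E.
Proof. exact: probability_setT. Qed.

HB.instance Definition _ := Kernel_isProbability.Build _ _
  (unit * borel (prodS X J))%type
  (borel (prodS X S)) R joined_kernel joined_kernel1.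

Definition marginal_kernel :
    unit -> {measure set (borel (prodS X J)) -> \bar R} :=
  fun=> marginal JS P.

Let marginal_kernel_measurable (A : set (borel (prodS X J))) : measurable A ->
  measurable_fun [set: unit] (marginal_kernel ^~ A).
Proof. by []. Qed.

HB.instance Definition _ := isKernel.Build _ _ unit
  (borel (prodS X J)) R marginal_kernel marginal_kernel_measurable.

Let marginal_kernel1 p : marginal_kernel p setT = 1%E.
Proof. exact: probability_setT. Qed.

HB.instance Definition _ := Kernel_isProbability.Build _ _ unit
  (borel (prodS X J)) R marginal_kernel marginal_kernel1.

(** Drawing x from the marginal and then y from Q(x) gives back P: this holds
on rectangles by the definition of a disintegration, and rectangles form a
pi-system which contains all coordinate cylinders. *)
Lemma disintegration_kcomp (A : set (borel (prodS X S))) : measurable A ->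
  P A = kcomp marginal_kernel joined_kernel tt A.
Proof.
pose G : set (set (borel (prodS X S))) :=
  [set restr JS @^-1` A `&` restr (finset.subsetIl S (~: J)) @^-1` B |
    A in (@measurable _ (borel (prodS X J))) &
    B in (@measurable _ (borel (prodS X W)))].
apply: (@measure_unique _ _ _ G (fun=> setT) _ _ _ _ P
  (mkcomp marginal_kernel joined_kernel tt)).
- rewrite eqEsubset; split => B; last first.
    apply: smallest_sub; first exact: sigma_algebra_measurable.
    move=> _ [C mC [D mD <-]]; apply: measurableI.
      by rewrite -[X in measurable X]setTI; exact: restr_measurable.
    by rewrite -[X in measurable X]setTI; exact: restr_measurable.
  rewrite (borel_prodS_cylinders S base).
  apply: smallest_sub; first exact: smallest_sigma_algebra.
  move=> _ [j [C [oC ->]]]; apply: sub_sigma_algebra.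
  have [jJ|jJ] := boolP (val j \in J).
    exists ((fun x : prodS X J => x (exist _ (val j) jJ)) @^-1` C).
      exact: (measurable_coordinate (j := exist _ (val j) jJ)).
    exists setT => //; rewrite preimage_setT setIT.
    rewrite -comp_preimage; congr (_ @^-1` C).
    by apply/funext => z; exact: restrE.
  have jW := joinS_mem cov (valP j) jJ.
  exists setT => //.
  exists ((fun x : prodS X W => x (exist _ (val j) jW)) @^-1` C).
    exact: (measurable_coordinate (j := exist _ (val j) jW)).
  rewrite preimage_setT setTI.
  rewrite -comp_preimage; congr (_ @^-1` C).
  by apply/funext => z; exact: restrE.
- move=> _ _ [B mB [C mC <-]] [B' mB' [C' mC' <-]].
  exists (B `&` B'); first exact: measurableI.
  exists (C `&` C'); first exact: measurableI.
  by rewrite !preimage_setI setIACA.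
- move=> _; exists setT => //; exists setT => //.
  by rewrite !preimage_setT setIT.
- exact: bigcup_const.
- move=> _ [B mB [C mC <-]]; rewrite /mkcomp/= /kcomp -disQ.2//.
  rewrite [LHS]integral_mkcond; apply: eq_integral => x _ /=.
  have WJ : W \subset ~: J := finset.subsetIr S (~: J).
  transitivity (Q x [set y | B x /\ C y]).
    rewrite patchE; case: ifPn => [/set_mem Bx|/negP nBx].
      by congr (Q x _); apply/seteqP; split => y //= [].
    rewrite [X in Q x X](_ : _ = set0) ?measure0// -subset0 => y [Bx _].
    by apply: nBx; exact: mem_set.
  rewrite /distribution /pushforward; congr (Q x _).
  by apply/seteqP; split => y /=; rewrite restr_joinSJ restr_joinSW.
- move=> _; apply: (@le_lt_trans _ _ 1%E); last exact: ltry.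
  exact: (@probability_le1 _ _ _ P).
Qed.

Lemma ge0_integral_disintegration (f : borel (prodS X S) -> \bar R) :
  measurable_fun setT f -> (forall z, 0 <= f z)%E ->
  (\int[P]_z f z = \int[marginal JS P]_x \int[Q x]_y f (joinS cov x y))%E.
Proof.
move=> mf f0.
rewrite (eq_measure_integral
  (mkcomp marginal_kernel joined_kernel tt)); last first.
  by move=> A mA _; exact: disintegration_kcomp.
rewrite integral_kcomp//; apply: eq_integral => x _.
by rewrite /= ge0_integral_distribution.
Qed.

Lemma measurable_integral_section (f : borel (prodS X S) -> \bar R) :
  measurable_fun setT f -> (forall z, 0 <= f z)%E ->
  measurable_fun [set: borel (prodS X J)]
    (fun x => \int[Q x]_y f (joinS cov x y))%E.
Proof.
move=> mf f0.
have mfj := measurableT_comp mf (joinS_measurable cov base).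
have := @measurable_fun_integral_finite_kernel _ _ _ _ R
  (fun p : borel (prodS X J) * borel (prodS X W) => f (joinS cov p.1 p.2))
  cond_kernel (fun p => f0 _) mfj.
exact.
Qed.

End disintegration_integral.

Section bounded_disintegration.
Context {I : finType} (X : I -> ptopologicalType) {R : realType}.
Hypothesis base : forall j, @second_countable (X j).
Context (J S : {set I}) (JS : J \subset S).
Notation W := (S :&: ~: J).
Context (P : probability (borel (prodS X S)) R).
Context (Q : prodS X J -> probability (borel (prodS X W)) R).
Hypothesis disQ : disintegration JS P Q.
Context (f : borel (prodS X S) -> R) (mf : measurable_fun setT f).
Context (M : R) (fM : forall z, `|f z| <= M).

Notation cov := (subset_setU_setIC J S).

(** Adding the constant M reduces to the case of a nonnegative function, since
all the measures involved have mass one. *)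
Lemma integral_disintegration :
  (marginal JS P).-integrable setT
    (fun x => \int[Q x]_y (f (joinS cov x y))%:E)%E /\
  (\int[P]_z (f z)%:E =
   \int[marginal JS P]_x \int[Q x]_y (f (joinS cov x y))%:E)%E.
Proof.
pose F z := f z + M.
have F0 z : (0 <= (F z)%:E)%E.
  rewrite lee_fin /F -lerBlDr sub0r.
  by have := fM z; rewrite ler_norml => /andP[].
have mF : measurable_fun setT (EFin \o F).
  by apply/measurable_EFinP; exact: measurable_funD.
pose H x := (\int[Q x]_y (F (joinS cov x y))%:E)%E.
have fjoinS x : (Q x).-integrable setT (EFin \o (f \o joinS cov x)).
  apply: probability_bounded_integrable; last by exists M => y; exact: fM.
  exact: measurableT_comp mf (joinS_section_measurable base x).
have iM d (T : measurableType d) (mu : probability T R) :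
    mu.-integrable setT (fun=> M%:E)%E.
  exact: finite_measure_integrable_cst.
have FE d (T : measurableType d) (mu : probability T R) (g : T -> R) :
    mu.-integrable setT (EFin \o g) ->
    (\int[mu]_x (g x)%:E = \int[mu]_x (g x + M)%:E - M%:E)%E.
  move=> ig; under [in RHS]eq_integral do rewrite EFinD.
  rewrite integralD//; last exact: finite_measure_integrable_cst.
  by rewrite probability_integral_cst addeK.
have HE x : (\int[Q x]_y (f (joinS cov x y))%:E = H x - M%:E)%E by exact: FE.
have mH : measurable_fun [set: borel (prodS X J)] H.
  exact: (measurable_integral_section base disQ mF F0).
have iH : (marginal JS P).-integrable setT H.
  apply/integrableP; split => //.
  under eq_integral do rewrite gee0_abs ?integral_ge0//.
  rewrite -(ge0_integral_disintegration base disQ mF F0).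
  under eq_integral do rewrite /= EFinD.
  apply: integrable_lty => //; apply: integrableD => //.
    by apply: probability_bounded_integrable => //; exists M.
  exact: iM.
split.
  rewrite (_ : (fun x => _) = (fun x => H x - M%:E)%E); last first.
    by apply/funext => x; exact: HE.
  exact: (integrableB measurableT iH (iM _ _ (marginal JS P))).
rewrite FE; last by apply: probability_bounded_integrable => //; exists M.
rewrite (ge0_integral_disintegration base disQ mF F0).
under [in RHS]eq_integral do rewrite HE.
rewrite (integralB measurableT iH (iM _ _ (marginal JS P))).
by rewrite (probability_integral_cst (marginal JS P)).
Qed.

End bounded_disintegration.

(** * Value of a family of functions *)

Lemma usc_bounded_measurable {R : realType} (T : ptopologicalType)
  (f : T -> R) :
  @usc_bounded R T f ->
  measurable_fun [set: borel T] (f : borel T -> R).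
Proof.
move=> [_ _ /lower_semicontinuousP lscf].
suff : measurable_fun [set: borel T] ((fun x => - f x) : borel T -> R).
  move=> /measurable_funN/=; apply: eq_measurable_fun => x _ /=.
  by rewrite opprK.
apply: (measurability _ (RGenOInfty.measurableE R)) => /= _ [_ [a ->]] <-.
rewrite setTI; apply: sub_sigma_algebra.
have := lscf a; congr (open _); apply/seteqP; split => x /=.
  by rewrite lte_fin in_itv/= andbT.
by rewrite lte_fin in_itv/= andbT.
Qed.

Lemma usc_bounded_norm {R : realType} (T : topologicalType) (f : T -> R) :
  @usc_bounded R T f -> exists M, forall z, `|f z| <= M.
Proof.
move=> [_ [M [_ fM]] _]; exists (M + 1) => z.
by apply: fM => //; rewrite ltrDl.
Qed.

(** If some term exceeds the number of terms, its truncation alone compensates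
all the others, each of which is at least -1. *)
Lemma sum_min_card_ge0 {R : realType} (K : finType) (a : K -> R) :
  (forall k, -1 <= a k) -> 0 <= \sum_k a k ->
  0 <= \sum_k Num.min (a k) #|K|%:R.
Proof.
move=> a1 a0; have [/forallP small|] := boolP [forall k, a k <= #|K|%:R].
  by under eq_bigr do rewrite min_l ?small//.
move=> /forallPn/=[k]; rewrite -ltNge => big.
rewrite (bigD1 k)//= min_r; last exact: ltW.
rewrite -lerBlDl sub0r; apply: (@le_trans _ _ (\sum_(i | i != k) (-1))).
  rewrite sumr_const mulNrn lerN2 ler_nat; exact: max_card.
apply: ler_sum => i _; rewrite le_min a1/=.
by rewrite (le_trans (lerN10 _)).
Qed.

Section payoff.
Context {I : finType} (X : I -> ptopologicalType) {R : realType}.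
Context {U : {set I}} {K : finType} {s : K -> {set I}}.
Context (sU : forall k, s k \subset U).

Lemma GplusP (f : forall k, prodS X (s k) -> R) :
  Gplus sU f <-> (forall k, @usc_bounded R (prodS X (s k)) (f k)) /\
    forall x : prodS X U, 0 <= \sum_k f k (restr (sU k) x).
Proof.
split=> [[uf f0]|[uf f0]]; split.
- by move=> k; have := uf k; rewrite inE.
- move=> x; rewrite -lee_fin; apply: le_trans f0 _.
  by apply: ereal_inf_lbound; exists x.
- by move=> k; rewrite inE.
- by apply: le_ereal_inf_tmp => _ [x _ <-]; rewrite lee_fin.
Qed.

(** The quantity of which incompat is the supremum over Gplus. *)
Definition payoff (P : forall k, probability (borel (prodS X (s k))) R)
    (f : forall k, prodS X (s k) -> R) : \bar R :=
  (- ((#|K|%:R^-1)%:E * \sum_k \int[P k]_x (f k x)%:E))%E.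

Variable P : forall k, probability (borel (prodS X (s k))) R.

Lemma Gplus_integrable (f : forall k, prodS X (s k) -> R) : Gplus sU f ->
  forall k, (P k).-integrable setT
    (fun x : borel (prodS X (s k)) => (f k x)%:E).
Proof.
move=> /GplusP[uf _] k; apply: probability_bounded_integrable.
  exact: (@usc_bounded_measurable R (prodS X (s k)) (f k) (uf k)).
exact: (usc_bounded_norm (uf k)).
Qed.

Lemma le_payoff (f g : forall k, prodS X (s k) -> R) :
  (forall k, (P k).-integrable setT
    (fun x : borel (prodS X (s k)) => (f k x)%:E)) ->
  (forall k, (P k).-integrable setT
    (fun x : borel (prodS X (s k)) => (g k x)%:E)) ->
  (forall k x, f k x <= g k x) -> (payoff P g <= payoff P f)%E.
Proof.
move=> fi gi fg; rewrite /payoff leeN2 lee_wpmul2l ?lee_fin ?invr_ge0//.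
by apply: lee_sum => k _; apply: le_integral => // x _; rewrite lee_fin.
Qed.

(** Members are at least -1, so the value is at most that of the family
constantly equal to -1, which is 1, or 0 for an empty collection. *)
Lemma payoff_le1 (f : forall k, prodS X (s k) -> R) : Gplus sU f ->
  (payoff P f <= 1)%E.
Proof.
move=> Gf; apply: (@le_trans _ _ (payoff P (fun _ _ => -1))).
  apply: le_payoff => [k||k x].
  - exact: finite_measure_integrable_cst.
  - exact: Gplus_integrable.
  - by have /GplusP[/(_ k) [+ _ _] _] := Gf; exact.
rewrite /payoff (eq_bigr (fun=> (-1)%:E)) => [|k _]; last first.
  exact: probability_integral_cst.
rewrite sumEFin sumr_const mulNrn -EFinM -EFinN lee_fin mulrN opprK.
have [->|K0] := eqVneq #|K| 0%N; first by rewrite mulr0.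
by rewrite mulVf// pnatr_eq0.
Qed.

Lemma incompat_ge0 : (0 <= incompat sU P)%E.
Proof.
apply: ereal_sup_ubound; exists (fun _ _ => 0); last first.
  by rewrite big1 ?mule0 ?oppe0// => k _; rewrite integral0.
apply/GplusP; split => [k|x]; last by rewrite big1.
split => [x||]; first by rewrite lerN10.
- by exists 0; split; rewrite ?num_real// => M M0 x _; rewrite normr0 ltW.
- by move=> x a; rewrite oppr0 => a0; exists setT; [exact: filterT|].
Qed.

End payoff.

(** * Conditioning on a common block of coordinates *)

Section conditioning.
Context {I : finType} (X : I -> ptopologicalType) {R : realType}.
Hypothesis base : forall j, @second_countable (X j).
Context (J : {set I}) {K : finType} (s : K -> {set I}).
Context (JS : forall k, J \subset s k).
Context (P : forall k, probability (borel (prodS X (s k))) R).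
Context (PJ : probability (borel (prodS X J)) R).
Hypothesis marginalP : forall k (A : set (borel (prodS X J))),
  measurable A -> marginal (JS k) (P k) A = PJ A.
Context (Q : forall k, prodS X J ->
  probability (borel (prodS X (s k :&: ~: J))) R).
Hypothesis disQ : forall k, disintegration (JS k) (P k) (Q k).

Notation cov k := (subset_setU_setIC J (s k)).

Definition slice (x : prodS X J) (f : forall k, prodS X (s k) -> R) k
  (y : prodS X (s k :&: ~: J)) : R := f k (joinS (cov k) x y).

(** Slices are compositions with the continuous map y |-> (x, y), and a point
of the complement of J is completed by x into a point of the full product, at
which the sum of the family is nonnegative. *)
Lemma slice_Gplus (x : prodS X J) (f : forall k, prodS X (s k) -> R) :
  Gplus (fun k => finset.subsetT (s k)) f ->
  Gplus (fun k => finset.subsetIr (s k) (~: J)) (slice x f).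
Proof.
move=> /GplusP[uf f0]; apply/GplusP; split => [k|y].
  have [f1 [M [Mr fM]] lscf] := uf k; split.
  - by move=> y; exact: f1.
  - by exists M; split => // r Mr' y _; exact: fM.
  - move=> y a afy; have [V Vy Va] := lscf _ _ afy.
    exists (joinS (cov k) x @^-1` V); first exact: joinS_continuous.
    by move=> z; exact: Va.
have cT : (finset.setT : {set I}) \subset J :|: ~: J by rewrite finset.setUCr.
have := f0 (joinS cT x y); congr (_ <= _); apply: eq_bigr => k _.
by rewrite /slice (restr_joinS _ (cov k) _ (finset.subsetIr (s k) (~: J))).
Qed.

Lemma payoff_disintegration (f : forall k, prodS X (s k) -> R) :
  (forall k, measurable_fun [set: borel (prodS X (s k))] (f k)) ->
  (forall k, exists M, forall z, `|f k z| <= M) ->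
  PJ.-integrable setT (fun x : borel (prodS X J) =>
     payoff (fun k => Q k x) (slice x f)) /\
  payoff P f = (\int[PJ]_x payoff (fun k => Q k x) (slice x f))%E.
Proof.
move=> mf bf; pose h k (x : borel (prodS X J)) :=
  (\int[Q k x]_y (slice x f y)%:E)%E.
have mPJ k : forall A, measurable A -> A `<=` setT ->
    marginal (JS k) (P k) A = PJ A.
  by move=> A mA _; exact: marginalP.
have dis k : PJ.-integrable setT (h k) /\
    (\int[P k]_z (f k z)%:E = \int[PJ]_x h k x)%E.
  have [M fM] := bf k.
  have [hi hE] := integral_disintegration base (disQ k) (mf k) fM.
  split; last by rewrite hE; exact: eq_measure_integral (mPJ k).
  move/integrableP : hi => [mh hoo]; apply/integrableP; split => //.
  by rewrite -(eq_measure_integral _ (mPJ k)).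
have hi : PJ.-integrable setT (fun x => (#|K|%:R^-1)%:E * \sum_k h k x)%E.
  apply: integrableZl => //; apply: integrable_sum => // k _.
  by case: (dis k).
split; first exact: integrableN hi.
rewrite /payoff -/h integralN; last exact: integrable_add_def.
congr (- _)%E; rewrite integralZl//; last first.
  by apply: integrable_sum => // k _; case: (dis k).
congr (_ * _)%E; rewrite integral_sum// => [|k]; last by case: (dis k).
by apply: eq_bigr => k _; case: (dis k).
Qed.

Lemma incompat_le :
  (incompat (fun k => finset.subsetT (s k)) P <=
   \int[PJ]_x incompat (fun k => finset.subsetIr (s k) (~: J))
     (fun k => Q k x))%E.
Proof.
apply: ge_ereal_sup => _ [f Gf <-]; rewrite -/(payoff P f).
have [uf _] := (GplusP _ _).1 Gf.
have [_ ->] := payoff_disintegration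
  (fun k => @usc_bounded_measurable R (prodS X (s k)) (f k) (uf k))
  (fun k => usc_bounded_norm (uf k)).
apply: le_lower_integral => x; first exact: incompat_ge0.
by apply: ereal_sup_ubound; exists (slice x f) => //; exact: slice_Gplus.
Qed.

Hypothesis discreteX : forall j (A : set (X j)), open A.

(** Finiteness of the set of coordinates makes every singleton a
neighbourhood of its point. *)
Lemma discrete_prodS (S : {set I}) (A : set (prodS X S)) : open A.
Proof.
rewrite openE => x Ax.
apply: (@filterS _ (nbhs x) _ [set z | forall j, z j = x j]).
  by move=> z zx; rewrite (_ : z = x)//; apply: functional_extensionality_dep.
apply: (@filter_forall (prodS X S) {j | j \in S} (fun j z => z j = x j)
  (nbhs x)) => j.
apply: (@proj_continuous {j : I | j \in S} (fun j => X (val j)) j x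
  [set y | y = x j]).
by apply: open_nbhs_nbhs; split => //; exact: discreteX.
Qed.

(** Near-optimal families for the conditional problems are pasted together
along x. No regularity in x has to be checked, since every function on a
discrete space is measurable and upper semi-continuous. *)
Lemma incompat_ge :
  (\int[PJ]_x incompat (fun k => finset.subsetIr (s k) (~: J))
     (fun k => Q k x) <=
   incompat (fun k => finset.subsetT (s k)) P)%E.
Proof.
apply/lee_addgt0Pr => e e0.
pose RQ x := incompat (fun k => finset.subsetIr (s k) (~: J)) (fun k => Q k x).
have /choice[F FP] x : exists F : forall k, prodS X (s k :&: ~: J) -> R,
    Gplus (fun k => finset.subsetIr (s k) (~: J)) F /\
    (RQ x <= payoff (fun k => Q k x) F + e%:E)%E.
  have [|_ [F GF <-] FE] :=
      @ub_ereal_sup_adherent R _ e e0 (_ : RQ x \is a fin_num).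
    rewrite ge0_fin_numE; last exact: incompat_ge0.
    apply: le_lt_trans (ltry 1); apply: ge_ereal_sup => _ [F GF <-].
    exact: (payoff_le1 (fun k => Q k x) GF).
  exists F; split => //; rewrite -leeBlDr//; exact: ltW.
(* The families F x need not be bounded uniformly in x, hence the truncation;
   #|K| is the level at which it preserves nonnegative sums. *)
pose f k (z : prodS X (s k)) := Num.min
  (F (restr (JS k) z) k (restr (finset.subsetIl (s k) (~: J)) z)) #|K|%:R.
have Gf : Gplus (fun k => finset.subsetT (s k)) f.
  apply/GplusP; split => [k|z].
    have f1 y : -1 <= f k y.
      rewrite /f le_min; apply/andP; split; last first.
        by rewrite (le_trans (lerN10 _)).
      have [/GplusP[/(_ k)[+ _ _] _] _] := FP (restr (JS k) y); exact.
    split => //.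
    - exists (1 + #|K|%:R); split; rewrite ?num_real// => r rK y _ /=.
      rewrite ler_norml; apply/andP; split.
        apply: le_trans (f1 y); rewrite lerN2; apply: le_trans (ltW rK).
        by rewrite lerDl.
      rewrite /f ge_min; apply/orP; right; apply: le_trans (ltW rK).
      by rewrite lerDr.
    - move=> y a ya; exists [set y]; last by move=> _ ->.
      by apply: open_nbhs_nbhs; split => //; exact: discrete_prodS.
  have [/GplusP[F1 F0] _] := FP (restr (finset.subsetT J) z).
  have := @sum_min_card_ge0 R K (fun k => F (restr (finset.subsetT J) z) k
    (restr (finset.subsetIr (s k) (~: J)) (restr (finset.subsetT (~: J)) z))).
  move=> /(_ _ (F0 _)) h; apply: le_trans (h _) _.
    by move=> k; have [+ _ _] := F1 k; exact.
  apply: ler_sum => k _; rewrite /f.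
  rewrite !(restr_restr _ _ (finset.subsetT J)).
  by rewrite !(restr_restr _ _ (finset.subsetT (s k :&: ~: J))).
have sf x k y : slice x f y = Num.min (F x k y) #|K|%:R.
  by rewrite /slice /f restr_joinSJ restr_joinSW//; exact: finset.subsetIr.
have [uf _] := (GplusP _ _).1 Gf.
have [fi fE] := payoff_disintegration
  (fun k => @usc_bounded_measurable R (prodS X (s k)) (f k) (uf k))
  (fun k => usc_bounded_norm (uf k)).
apply: (@le_trans _ _ (payoff P f + e%:E)%E); last first.
  by rewrite leeD2r//; apply: ereal_sup_ubound; exists f.
have -> : (payoff P f + e%:E =
    \int[PJ]_x (payoff (fun k => Q k x) (slice x f) + e%:E))%E.
  rewrite integralD//; last exact: finite_measure_integrable_cst.
  by rewrite -fE probability_integral_cst.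
have le_RQ x : (RQ x <= payoff (fun k => Q k x) (slice x f) + e%:E)%E.
  have [GFx FxE] := FP x; apply: (le_trans FxE); rewrite leeD2r//.
  apply: le_payoff.
  - exact: Gplus_integrable (slice_Gplus x Gf).
  - exact: Gplus_integrable GFx.
  - by move=> k y; rewrite sf ge_min lexx.
apply: le_lower_integral => // x.
by apply: le_trans (le_RQ x); exact: incompat_ge0.
Qed.

End conditioning.

Theorem proposition10 (R : realType) (d : nat) (X : 'I_d -> ptopologicalType)
  (polishX : forall j, polish R (X j))
  (SS : {set {set 'I_d}}) (J : {set 'I_d})
  (JS : forall S : {S : {set 'I_d} | S \in SS}, J \subset val S)
  (P : forall S : {S : {set 'I_d} | S \in SS},
         probability (borel (prodS X (val S))) R)
  (PJ : probability (borel (prodS X J)) R)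
  (marginalP : forall (S : {S : {set 'I_d} | S \in SS})
                      (A : set (borel (prodS X J))),
     measurable A -> marginal (JS S) (P S) A = PJ A)
  (Q : forall S : {S : {set 'I_d} | S \in SS}, prodS X J ->
         probability (borel (prodS X (val S :&: ~: J))) R)
  (disintegrationQ : forall S : {S : {set 'I_d} | S \in SS},
     disintegration (JS S) (P S) (Q S)) :
  let RP := incompat (fun S => finset.subsetT (val S)) P in
  let RQ (xJ : prodS X J) :=
    incompat (fun S => finset.subsetIr (val S) (~: J)) (fun S => Q S xJ) in
  (RP <= \int[PJ]_xJ RQ xJ)%E /\
  ((exists m : 'I_d -> option nat, forall j, discrete_segment (X j) (m j)) ->
   RP = (\int[PJ]_xJ RQ xJ)%E).
Proof.
have base j : @second_countable (X j) := polish_second_countable (polishX j).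
move=> RP RQ; split.
  exact: (incompat_le base marginalP disintegrationQ).
move=> [m discreteX]; apply/eqP; rewrite eq_le; apply/andP; split.
  exact: (incompat_le base marginalP disintegrationQ).
apply: (incompat_ge base marginalP disintegrationQ) => j A.
by have [+ _] := discreteX j; exact.
Qed.
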